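(* Let $\mathbf p$ be a path in $Q_G$ which lies in $\mathrm{supp}(\omega_G)$. Then there exists a path $\tilde{\mathbf p}\in\mathrm{supp}(\omega_A)$ such that $\Psi(\mathbf p)=\Phi(\tilde{\mathbf p})$.
   Context: Group. Let $m,r,s,t$ be positive integers with $\gcd(m,r)=1$; $r^s\equiv 1\pmod m$; $(r-1)t\equiv 0\pmod m$; $s$ prime; $r\not\equiv 1\pmod m$. Write $\epsilon_k$ for a fixed primitive $k$-th root of unity. $G\le\mathrm{GL}(s,\mathbb C)$ is generated by $\alpha=\mathrm{diag}(\epsilon_m,\epsilon_m^r,\dots,\epsilon_m^{r^{s-1}})$ and $\beta$, where $\beta e_k=e_{k+1}$ for $1\le k\le s-1$ and $\beta e_s=\epsilon_m^te_1$. $A=\langle\alpha\rangle$ is normal, cyclic of order $m$, and $G/A$ is cyclic of order $s$ generated by the class of $\beta$. Put $c=\sum_{k=0}^{s-1}r^k$ and $V=\mathbb C^s$ (natural representation). Representations. $S_i=\mathbb Cv_i$ ($i\in\mathbb Z/m\mathbb Z$) is the representation of $A$ with $\alpha v_i=\epsilon_m^iv_i$; $T_i=\mathrm{Ind}_A^G(S_i)$ has basis $v_i,\beta v_i,\dots,\beta^{s-1}v_i$ (with $\beta^sv_i=\epsilon_m^{ti}v_i$); $V=T_1$. $G/A$ acts on $\mathbb Z/m\mathbb Z$ by $i\mapsto ri$; $\mathcal F$ is the set of fixed points and $\mathcal D\supseteq\mathcal F$ a fixed set of representatives of the orbits, assumed closed under $i\mapsto i+c$. For $i\in\mathcal F$,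 $0\le\ell\le s-1$: $\eta_i$ is a fixed $s$-th root of $\epsilon_m^{ti}$, $\lambda_{i,\ell}=\eta_i\epsilon_s^\ell$, $w_i^{(\ell)}=\sum_{k=0}^{s-1}\lambda_{i,\ell}^{s-1-k}\beta^kv_i$, $T_i^{(\ell)}=\mathbb Cw_i^{(\ell)}$, and $T_i=\bigoplus_\ell T_i^{(\ell)}$. The irreducible representations of $G$ are $T_i$ ($i\in\mathcal D\smallsetminus\mathcal F$) and $T_i^{(\ell)}$ ($i\in\mathcal F$). $Q_A$. Vertices $\mathbb Z/m\mathbb Z$, arrows $x_q^i\colon i\to i-r^q$ for $0\le q\le s-1$. $\omega_A=\sum_i\sum_{\sigma\in\mathfrak S_s}(-1)^\sigma\mathbf p^i_\sigma$, where $\mathfrak S_s$ is the symmetric group on $\{0,\dots,s-1\}$ and $\mathbf p_\sigma^i$ is the path starting at $i$ and running successively through arrows of type $x_{\sigma(0)},x_{\sigma(1)},\dots,x_{\sigma(s-1)}$. $Q_G$. Vertices $i$ (for $T_i$, $i\in\mathcal D\smallsetminus\mathcal F$) and $i^{(\ell)}$ (for $T_i^{(\ell)}$, $i\in\mathcal F$). Arrows (indices $p,a\in\{0,\dots,s-1\}$, read modulo $s$): (1) for $i,j\in\mathcal D\smallsetminus\mathcal F$, $x^i_{p,a}\colon i\to j$ whenever $r^aj\equiv i-r^p$, representing the $G$-map $T_i\to V\otimes T_j$, $v_i\mapsto\beta^pv_1\otimes\beta^av_j$; (2) for $i\in\mathcal D\smallsetminus\mathcal F$, $j\in\mathcal F$,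 $x^{i(\ell)}_{p,0}\colon i\to j^{(\ell)}$ whenever $j\equiv i-r^p$, representing the map $T_i\to V\otimes T_j$, $v_i\mapsto\beta^pv_1\otimes v_j$, followed by the projection $V\otimes T_j\to V\otimes T_j^{(\ell)}$; (3) for $i\in\mathcal F$, $j\in\mathcal D\smallsetminus\mathcal F$, $x^{(\ell)i}_{p,0}\colon i^{(\ell)}\to j$ whenever $j\equiv i-r^p$, representing the restriction to $T_i^{(\ell)}$ of $T_i\to V\otimes T_j$, $v_i\mapsto\beta^pv_1\otimes v_j$. There are no arrows between vertices coming from $\mathcal F$. (So arrows $S\to T$ form a basis of $\mathrm{Hom}_G(S,V\otimes T)$.) $\omega_G$. For a path $p\colon S_1\xrightarrow{a_1}S_2\to\cdots\xrightarrow{a_s}S_{s+1}$ in $Q_G$, the composition $S_1\to V\otimes S_2\to\cdots\to V^{\otimes s}\otimes S_{s+1}\to\bigwedge^sV\otimes S_{s+1}$ (last map the antisymmetrizer $x_1\otimes\cdots\otimes x_s\mapsto x_1\wedge\cdots\wedge x_s$ tensored with the identity) is, after identifying $\bigwedge^sV\otimes S_{s+1}=\det_V\otimes S_{s+1}$ with an element of $\mathrm{Irr}(G)$, multiplication by a scalar $c_p$; $\omega_G=\sum_pc_p\dim(S_{s+1})p$, over paths of length $s$. The support $\mathrm{supp}(\omega)$ of an element $\omega$ is the set of paths having nonzero coefficient in it. $\tilde Q_G$. Vertices $\mathcal D$; arrows: for $i,j\in\mathcal D\smallsetminus\mathcal F$ the same $x^i_{p,a}$ as in $Q_G$; for exactly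 one of $i,j$ in $\mathcal F$, an arrow $x^i_{p,0}\colon i\to j$ whenever $j\equiv i-r^p$ for some $p$. $\Phi\colon Q_A\to\tilde Q_G$. For $i\in\mathbb Z/m\mathbb Z$ let $\underline i\in\mathcal D$ be the representative of its orbit and $\kappa_i\in\{0,\dots,s-1\}$ with $r^{\kappa_i}\underline i\equiv i$ (unique if $i\notin\mathcal F$; $\kappa_i:=0$ if $i\in\mathcal F$). $\Phi(i)=\underline i$ and $\Phi(x^i_q)=x^{\underline i}_{p,a}\colon \underline i\to\underline{i-r^q}$, where $(p,a)=(q-\kappa_i,\kappa_{i-r^q}-\kappa_i)$ if $\underline i,\underline{i-r^q}\notin\mathcal F$; $(p,a)=(q-\kappa_i,0)$ if $\underline i\notin\mathcal F$, $\underline{i-r^q}\in\mathcal F$; $(p,a)=(q-\kappa_{i-r^q},0)$ if $\underline i\in\mathcal F$, $\underline{i-r^q}\notin\mathcal F$. $\Psi\colon Q_G\to\tilde Q_G$. $\Psi(i)=i$, $\Psi(i^{(\ell)})=i$, $\Psi(x^i_{p,a})=x^i_{p,a}$, $\Psi(x^{i(\ell)}_{p,0})=x^i_{p,0}$, $\Psi(x^{(\ell)i}_{p,0})=x^i_{p,0}$. Quiver morphisms are applied to paths arrow by arrow. *)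

(* Defs.v *)
From HB Require Import structures.
From mathcomp Require Import all_boot all_order all_algebra all_fingroup.
From mathcomp Require Import classical_sets reals complex.

Set Implicit Arguments.
Unset Strict Implicit.
Unset Printing Implicit Defensive.

Import GRing.Theory.
Local Open Scope ring_scope.

(* An arrow is the triple (source, label, target); parallel arrows are
   distinguished by their labels.  The predicates select the actual vertices
   and arrows among all candidates. *)
Record quiver := Quiver {
  vtx : eqType;
  lbl : eqType;
  is_vertex : pred vtx;
  is_arrow : pred (vtx * lbl * vtx)%type
}.

Definition arr (Q : quiver) : eqType := (vtx Q * lbl Q * vtx Q)%type.
Definition src (Q : quiver) (a : arr Q) : vtx Q := a.1.1.
Definition lab (Q : quiver) (a : arr Q) : lbl Q := a.1.2.
Definition tgt (Q : quiver) (a : arr Q) : vtx Q := a.2.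

(* A starting vertex together with a list of arrows in order of traversal. *)
Definition qpath (Q : quiver) : eqType := (vtx Q * seq (arr Q))%type.

Definition is_qpath (Q : quiver) (p : qpath Q) : bool :=
  [&& is_vertex p.1, all (@is_arrow Q) p.2 &
      map (@src Q) p.2 == belast p.1 (map (@tgt Q) p.2)].

Definition qend (Q : quiver) (p : qpath Q) : vtx Q := last p.1 (map (@tgt Q) p.2).

Definition map_qpath (Q Q' : quiver) (fv : vtx Q -> vtx Q') (fa : arr Q -> arr Q')
  (p : qpath Q) : qpath Q' := (fv p.1, map fa p.2).

(* A formal combination of paths is given by its coefficient function. *)
Definition supp (K : fieldType) (Q : quiver) (w : qpath Q -> K) : pred (qpath Q) :=
  fun p => w p != 0.

(* The index set Z/mZ is 'Z_m and the indices read modulo s are in 'Z_s; these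
   are the right types only when 1 < m and 1 < s, which always holds here
   because r is not 1 modulo m and s is prime. *)
Section McKay.

Variables (K : fieldType) (m r s t : nat) (eps : nat -> K).
Variables (D : {set 'Z_m}) (eta : 'Z_m -> K).

(* The basis vectors e_(k+1) of V, and beta^k v_i of T_i, are both [bv k]. *)
Definition bv (k : nat) : 'cV[K]_s := \col_(l < s) ((l : nat) == k)%:R.

Definition alpha : 'M[K]_s := diag_mx (\row_(k < s) eps m ^+ (r ^ k)).

Definition beta : 'M[K]_s :=
  \matrix_(k < s, l < s)
    if (l.+1 < s)%N then ((k : nat) == l.+1)%:R
    else ((k : nat) == 0%N)%:R * eps m ^+ t.

Inductive inG : 'M[K]_s -> Prop :=
| inG_alpha : inG alpha
| inG_beta : inG beta
| inG_one : inG 1%:M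
| inG_mul g h : inG g -> inG h -> inG (g *m h)
| inG_inv g : inG g -> inG (invmx g).

(* The scalar by which h in A acts on v_i; zero if h is not in A. *)
Definition Srep (i : 'Z_m) (h : 'M[K]_s) : K :=
  \sum_(a < m | h == alpha ^+ a) eps m ^+ (i * a).

(* Matrix of g on Ind_A^G(S_i) in the basis beta^k v_i, from
   g beta^l v_i = beta^k (beta^(-k) g beta^l) v_i for the only k for which
   beta^(-k) g beta^l lies in A. *)
Definition Trep (i : 'Z_m) (g : 'M[K]_s) : 'M[K]_s :=
  \matrix_(k < s, l < s) Srep i (invmx (beta ^+ k) *m g *m beta ^+ l).

Definition ract (k : nat) (i : 'Z_m) : 'Z_m := r%:R ^+ k * i.

Definition Fix : {set 'Z_m} := [set i | ract 1 i == i].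

Definition same_orbit (i j : 'Z_m) : bool := [exists k : 'I_s, ract k j == i].

Definition orbit_representatives : Prop :=
  forall i : 'Z_m, exists! j : 'Z_m, j \in D /\ same_orbit i j.

Definition csum : nat := \sum_(k < s) r ^ k.

Definition lam (i : 'Z_m) (l : 'I_s) : K := eta i * eps s ^+ l.

Definition wv (i : 'Z_m) (l : 'I_s) : 'cV[K]_s :=
  \sum_(k < s) lam i l ^+ (s.-1 - k) *: bv k.

(* The projection of T_i onto K w_i^(l) along the other K w_i^(l'). *)
Definition Tproj (i : 'Z_m) (l : 'I_s) : 'M[K]_s :=
  let W := \matrix_(k < s, l' < s) wv i l' k 0 in wv i l *m row l (invmx W).

Definition QA : quiver :=
  @Quiver 'Z_m 'I_s predT (fun x => x.2 == x.1.1 - r%:R ^+ x.1.2).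

Definition arrow_cond (i j : 'Z_m) (pa : 'Z_s * 'Z_s) : bool :=
  match i \in Fix, j \in Fix with
  | false, false => ract pa.2 j == i - r%:R ^+ pa.1
  | true, true => false
  | _, _ => (pa.2 == 0) && (j == i - r%:R ^+ pa.1)
  end.

(* (i, None) is the vertex i, and (i, Some l) is the vertex i^(l). *)
Definition vertexG (x : 'Z_m * option 'I_s) : bool :=
  (x.1 \in D) && (isSome x.2 == (x.1 \in Fix)).

(* The arrow (x, (p, a), y) is x^i_{p,a}, x^{i(l)}_{p,0} or x^{(l)i}_{p,0}, the
   superscript (l) being carried by y, respectively x. *)
Definition QG : quiver :=
  @Quiver ('Z_m * option 'I_s)%type ('Z_s * 'Z_s)%type vertexG
    (fun x => [&& vertexG x.1.1, vertexG x.2 & arrow_cond x.1.1.1 x.2.1 x.1.2]).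

Definition QtG : quiver :=
  @Quiver 'Z_m ('Z_s * 'Z_s)%type (mem D)
    (fun x => [&& x.1.1 \in D, x.2 \in D & arrow_cond x.1.1 x.2 x.1.2]).

(* The irreducible representation at a vertex, as a subspace of T_i = K^s. *)
Definition Vsp (x : vtx QG) : {vspace 'cV[K]_s} :=
  if x.2 is Some l then <[wv x.1 l]>%VS else fullv.

(* The G-map f : T_i -> V (x) T_j with f(v_i) = beta^p v_1 (x) beta^a v_j, hence
   f(beta^k v_i) = beta^(k+p) v_1 (x) beta^(k+a) v_j, is encoded by the matrices
   f_q with f(x) = \sum_q e_(q+1) (x) f_q x. *)
Definition Tmap (j : 'Z_m) (p a : nat) (q : 'I_s) : 'M[K]_s :=
  \matrix_(l < s, k < s)
    ((beta ^+ k *m bv p) q 0 * (Trep j (beta ^+ k) *m bv a) l 0).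

(* Restriction to Vsp (src a) is left implicit. *)
Definition arrow_mx (a : arr QG) (q : 'I_s) : 'M[K]_s :=
  let f := Tmap (tgt a).1 (lab a).1 (lab a).2 q in
  if (tgt a).2 is Some l then Tproj (tgt a).1 l *m f else f.

(* The component on e_(u_1+1) (x) ... (x) e_(u_n+1) of the image of x under
   S_1 -> V (x) S_2 -> ... -> V^(x)n (x) S_(n+1). *)
Definition path_comp (p : seq (arr QG)) (u : seq 'I_s) (x : 'cV[K]_s) : 'cV[K]_s :=
  foldl (fun y au => arrow_mx au.1 au.2 *m y) x (zip p u).

(* The composition S_1 -> wedge^s V (x) S_(s+1), where the line wedge^s V has
   basis e_1 /\ ... /\ e_s. *)
Definition wedge_comp (p : seq (arr QG)) (x : 'cV[K]_s) : 'cV[K]_s :=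
  \sum_(sg : 'S_s) (-1) ^+ sg *: path_comp p [seq sg k | k <- enum 'I_s] x.

(* [theta y] restricts to an isomorphism from the representation at [tau y]
   to det_V (x) (the representation at y). *)
Record det_ident := DetIdent {
  tau : vtx QG -> vtx QG;
  theta : vtx QG -> 'End('cV[K]_s)
}.

Definition is_det_ident (I : det_ident) : Prop :=
  forall y : vtx QG, is_vertex y ->
  [/\ is_vertex (tau I y),
      (theta I y @: Vsp (tau I y))%VS = Vsp y,
      (lker (theta I y) :&: Vsp (tau I y))%VS = 0%VS
    & forall g, inG g -> forall x, x \in Vsp (tau I y) ->
        theta I y (Trep (tau I y).1 g *m x) =
        \det g *: (Trep y.1 g *m theta I y x)].

(* If S_1 is not the representation identified with det_V (x) S_(s+1), then the
   composition is zero by Schur's lemma, and so is the coefficient. *)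
Definition coefG (I : det_ident) (p : qpath QG) : K :=
  if p.1 == tau I (qend p) then
    xget 0 (fun c : K => forall x, x \in Vsp p.1 ->
              wedge_comp p.2 x = c *: theta I (qend p) x)
  else 0.

Definition omegaG (I : det_ident) (p : qpath QG) : K :=
  if is_qpath p && (size p.2 == s) then coefG I p * (\dim (Vsp (qend p)))%:R
  else 0.

(* The path from i running through arrows with the given labels. *)
Fixpoint stepsA (i : 'Z_m) (u : seq 'I_s) : seq (arr QA) :=
  if u is q :: u' then (i, q, i - r%:R ^+ q) :: stepsA (i - r%:R ^+ q) u' else [::].

Definition pathA (i : 'Z_m) (sg : 'S_s) : qpath QA :=
  (i, stepsA i [seq sg k | k <- enum 'I_s]).

Definition omegaA (p : qpath QA) : K :=
  \sum_(i : 'Z_m) \sum_(sg : 'S_s) (-1) ^+ sg * (p == pathA i sg)%:R.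

Definition rep (i : 'Z_m) : 'Z_m := odflt i [pick j in D | same_orbit i j].

Definition kappa (i : 'Z_m) : 'Z_s :=
  if i \in Fix then 0 else odflt 0 [pick k : 'Z_s | ract k (rep i) == i].

Definition Phi_arr (x : arr QA) : arr QtG :=
  let i := src x in
  let q : 'Z_s := (lab x : nat)%:R in
  let j : 'Z_m := i - r%:R ^+ lab x in
  let pa : 'Z_s * 'Z_s :=
    if rep i \in Fix then (q - kappa j, 0)
    else if rep j \in Fix then (q - kappa i, 0)
    else (q - kappa i, kappa j - kappa i) in
  (rep i, pa, rep j).

Definition Phi : qpath QA -> qpath QtG := @map_qpath QA QtG rep Phi_arr.

Definition Psi_arr (x : arr QG) : arr QtG := ((src x).1, lab x, (tgt x).1).

Definition Psi : qpath QG -> qpath QtG := @map_qpath QG QtG fst Psi_arr.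

End McKay.

(* Main.v *)
(* The vector beta^k v_i of T_i has A-weight r^k i, and an arrow x_{p,a} sends it
   to beta^(k+p) v_1 (x) beta^(k+a) v_j, that is, it covers the arrow x_{k+p} of
   Q_A from r^k i to r^(k+a) j.  If a path p of Q_G has nonzero coefficient, then
   for some permutation sg the component of its composition on
   e_(sg 0) (x) ... (x) e_(sg (s-1)) is nonzero on some basis vector.  Once the
   letter sg n is known, nonvanishing leaves a single possible k at each step,
   also when the source is a fixed vertex, and the weights met along p trace the
   path of Q_A with labels sg. *)
Require Import Defs.
From HB Require Import structures.
From mathcomp Require Import all_boot all_order all_algebra all_fingroup.
From mathcomp Require Import classical_sets reals complex.

Set Implicit Arguments.
Unset Strict Implicit.
Unset Printing Implicit Defensive.

Import GRing.Theory.
Local Open Scope ring_scope.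

(** * Orbits of multiplication by $r$ on $\mathbb Z/m\mathbb Z$ and their representatives *)

Section Orbits.

Variables (m r s : nat) (D : {set 'Z_m}).
Hypotheses (s_prime : prime s) (rs1 : (r%:R : 'Z_m) ^+ s = 1).
Hypothesis D_repr : orbit_representatives r s D.

Local Notation ract := (Defs.ract r).
Local Notation Fix := (Fix m r).

Lemma ractD k l (i : 'Z_m) : ract (k + l) i = ract k (ract l i).
Proof. by rewrite /Defs.ract exprD mulrA. Qed.

Lemma ract_mod k (i : 'Z_m) : ract (k %% s) i = ract k i.
Proof. by rewrite /Defs.ract expr_mod. Qed.

Lemma FixP (i : 'Z_m) : reflect (ract 1 i = i) (i \in Fix).
Proof. by rewrite inE; apply: eqP. Qed.

Lemma ract_fixed k (i : 'Z_m) : i \in Fix -> ract k i = i.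
Proof.
move/FixP=> ri; elim: k => [|k IHk]; first by rewrite /Defs.ract mul1r.
by have := ractD k 1 i; rewrite addn1 ri => ->.
Qed.

(** As $r^s=1$, acting $k(s-1)$ more times inverts [ract k]. *)
Lemma ract_inj k : injective (ract k : 'Z_m -> 'Z_m).
Proof.
move=> i j /(congr1 (ract (k * s.-1))); rewrite -!ractD.
have -> : (k * s.-1 + k = s * k)%N.
  by rewrite addnC -mulnS prednK ?prime_gt0 // mulnC.
by rewrite /Defs.ract exprM rs1 expr1n !mul1r.
Qed.

Lemma ract_Fix k (i : 'Z_m) : (ract k i \in Fix) = (i \in Fix).
Proof.
by rewrite !inE -ractD addnC ractD (inj_eq (@ract_inj k)).
Qed.

(* As s is prime, a nontrivial stabilizer is all of Z/sZ. *)
Lemma ract_free k l (i : 'Z_m) :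
  i \notin Fix -> ract k i = ract l i -> k = l %[mod s].
Proof.
move=> iF; wlog lk : k l / (l <= k)%N.
  move=> wl; have [|/ltnW] := leqP l k; first exact: wl.
  by move=> kl /esym; move/(wl _ _ kl).
rewrite -(subnKC lk); set d := (k - l)%N; rewrite ractD => /ract_inj ri.
have rdi n : ract (n * d) i = i.
  elim: n => [|n IHn]; first by rewrite /Defs.ract mul1r.
  by rewrite mulSn ractD IHn.
have [sd | sNd] := boolP (s %| d)%N.
  by rewrite -modnDmr (eqP sd) addn0.
have /eqP g1 : coprime d s by rewrite coprime_sym prime_coprime.
case/negP: iF; apply/FixP.
have d0 : (0 < d)%N by case: (d) sNd => //; rewrite dvdn0.
(* Bezout: $ud=vs+1$. Both [d] and [s] steps fix [i], hence so does a single step. *)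
have [u v e _] := egcdnP s d0; rewrite g1 in e.
have vsi : ract (v * s) i = i by rewrite -ract_mod modnMl /Defs.ract mul1r.
by have := rdi u; rewrite e addnC ractD vsi.
Qed.

Lemma rep_ract k (j : 'Z_m) : j \in D -> rep r s D (ract k j) = j.
Proof.
move=> jD; have orb : same_orbit r s (ract k j) j.
  apply/existsP; exists (Ordinal (ltn_pmod k (prime_gt0 s_prime))).
  by rewrite ract_mod.
have [j0 [_ uniq_j0]] := D_repr (ract k j).
rewrite /rep; case: pickP => [j' /andP[j'D orb'] | /(_ j)]; last first.
  by rewrite jD orb.
by rewrite /= -(uniq_j0 j') ?(uniq_j0 j).
Qed.

(** Freeness of the orbit determines the index picked by [kappa] modulo [s], which is all that an
    equality in ['Z_s] requires. *)
Lemma kappa_ract k (j : 'Z_m) :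
  j \in D -> j \notin Fix -> kappa r s D (ract k j) = k%:R.
Proof.
move=> jD jF; have s1 := prime_gt1 s_prime.
rewrite /kappa ract_Fix (negPf jF) rep_ract //.
case: pickP => [k' /eqP/(ract_free jF) kk' | /(_ k%:R)]; last first.
  by rewrite val_Zp_nat // ract_mod eqxx.
by rewrite /= -[LHS]natr_Zp -Zp_nat_mod // kk' Zp_nat_mod.
Qed.

End Orbits.

(** * Index shifts of the matrices of $G$ and of the arrow maps *)

Section Monomial.

Variables (K : fieldType) (m r s t : nat) (eps : nat -> K).
Hypotheses (s_gt0 : (0 < s)%N) (eps_neq0 : eps m != 0).

Local Notation alpha := (alpha m r s eps).
Local Notation beta := (beta m s t eps).

(** Homogeneity of degree [n] for the $\mathbb Z/s$-grading in which the basis vector of index $j$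
    has degree $j$. *)
Definition shifts_by n (M : 'M[K]_s) : Prop :=
  forall i j, M i j != 0 -> i = j + n %[mod s].

Lemma sumr_neq0 (V : nmodType) (T : finType) (F : T -> V) :
  \sum_i F i != 0 -> exists i, F i != 0.
Proof.
move=> nz; apply/existsP; apply: contraR nz.
by rewrite negb_exists => /forallP F0; rewrite big1 // => i _; apply/eqP/negPn.
Qed.

Lemma mulmx_neq0 p q n (A : 'M[K]_(p, q)) (B : 'M[K]_(q, n)) i j :
  (A *m B) i j != 0 -> exists2 k, A i k != 0 & B k j != 0.
Proof.
rewrite mxE => /sumr_neq0[k]; rewrite mulf_eq0 negb_or => /andP[].
by exists k.
Qed.

Lemma shifts_byM n n' A B :
  shifts_by n A -> shifts_by n' B -> shifts_by (n + n') (A *m B).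
Proof.
move=> hA hB i j /mulmx_neq0[k /hA-> /hB kj].
by rewrite -modnDml kj modnDml addnAC addnA.
Qed.

Lemma shifts_by1 : shifts_by 0 1%:M.
Proof.
by move=> i j; rewrite mxE addn0; case: (i =P j) => [->|_] //; rewrite eqxx.
Qed.

Lemma shifts_byX n A k : shifts_by n A -> shifts_by (k * n) (A ^+ k).
Proof.
move=> hA; elim: k => [|k IHk]; first exact: shifts_by1.
by rewrite exprS mulSn; apply: shifts_byM.
Qed.

Lemma beta_shifts k : shifts_by k (beta ^+ k).
Proof.
rewrite -[k in shifts_by k]muln1; apply: shifts_byX => i j.
rewrite mxE; case: ifP => [_|jmax].
  by case: (_ =P j.+1) => [-> _|_]; rewrite ?eqxx // addn1.
case: (_ =P 0%N) => [-> _|_]; last by rewrite mul0r eqxx.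
(* The last column wraps around to row 0. *)
have -> : (j + 1 = s)%N; last by rewrite modnn mod0n.
by apply/eqP; rewrite addn1 eqn_leq ltn_ord leqNgt jmax.
Qed.

Lemma alpha_shifts k : shifts_by 0 (alpha ^+ k).
Proof.
rewrite -[in shifts_by _](muln0 k); apply: shifts_byX => i j.
rewrite mxE addn0; case: (i =P j) => [->|_] //.
by rewrite mulr0n eqxx.
Qed.

(** If $v\beta=0$, column $k-1$ isolates the coordinate $v_k$ for $k>0$; the last column isolates
    $v_0$ up to a power of [eps m]. *)
Lemma beta_unit : beta \in unitmx.
Proof.
rewrite -row_free_unit; apply: inj_row_free => v v0.
apply/rowP => k; rewrite mxE.
have vl (l : 'I_s) : \sum_k v 0 k * beta k l = 0.
  by move/rowP/(_ l): v0; rewrite !mxE.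
have [k0 | k_gt0] := posnP k.
  have lt_pred : (s.-1 < s)%N by rewrite prednK.
  have := vl (Ordinal lt_pred); rewrite (bigD1 k) //= big1 => [|i ik].
    rewrite addr0 mxE /= prednK // ltnn k0 eqxx mul1r => /eqP.
    by rewrite mulf_eq0 (negPf (expf_neq0 _ eps_neq0)) orbF => /eqP.
  rewrite mxE /= prednK // ltnn.
  suff -> : (i : nat) == 0%N = false by rewrite mul0r mulr0.
  by rewrite -k0; apply/negbTE.
have lt_pred : (k.-1 < s)%N by rewrite (leq_ltn_trans (leq_pred _)).
have := vl (Ordinal lt_pred); rewrite (bigD1 k) //= big1 => [|i ik].
  by rewrite addr0 mxE /= prednK // ltn_ord eqxx mulr1.
by rewrite mxE /= prednK // ltn_ord (inj_eq val_inj) (negPf ik) mulr0.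
Qed.

Lemma betaX_unit k : beta ^+ k \in unitmx.
Proof.
elim: k => [|k IHk]; first by rewrite expr0; apply: unitmx1.
by rewrite exprS -[_ * _]/(_ *m _) unitmx_mul beta_unit.
Qed.

(** After clearing the inverse, both sides are homogeneous, of degrees $n+k$ and $l$; a nonzero
    entry forces these to agree modulo [s]. *)
Lemma betaX_shift n k l b :
  beta ^+ n = beta ^+ l *m alpha ^+ b *m invmx (beta ^+ k) -> (n + k = l %[mod s])%N.
Proof.
move/(congr1 (mulmx^~ (beta ^+ k))); rewrite mulmxKV ?betaX_unit //.
rewrite -[beta ^+ n *m _]/(_ * _) -exprD => e.
have [i [j nz]] : exists i j, (beta ^+ (n + k)) i j != 0.
  (* A nonzero determinant has a nonzero Leibniz term; its factor in row 0 is the required entry. *)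
  have := betaX_unit (n + k); rewrite unitmxE unitfE /determinant.
  case/sumr_neq0=> sg; rewrite mulf_eq0 negb_or => /andP[_].
  move/prodf_neq0/(_ (Ordinal s_gt0) isT) => nz.
  by exists (Ordinal s_gt0), (sg (Ordinal s_gt0)).
have := nz; rewrite e => /(shifts_byM (@beta_shifts l) (@alpha_shifts b)).
rewrite (beta_shifts nz) addn0 => /eqP.
by rewrite eqn_modDl => /eqP.
Qed.

(** [Srep] vanishes off the powers of [alpha], so a nonzero entry gives
    $\beta^{-l}\beta^k\beta^{l'}=\alpha^a$, and degrees can be compared. *)
Lemma Trep_shifts (j : 'Z_m) k : shifts_by k (Trep r t eps j (beta ^+ k)).
Proof.
move=> l l'; rewrite mxE /Srep.
case: (pickP (fun a : 'I_m =>
  invmx (beta ^+ l) *m beta ^+ k *m beta ^+ l' == alpha ^+ a)) => [a | no_a].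
  move/eqP => e _; rewrite addnC; apply/esym/(@betaX_shift k l' l a).
  by rewrite -e !mulmxA mulmxV ?betaX_unit // mul1mx mulmxK ?betaX_unit.
by rewrite big_pred0 ?eqxx.
Qed.

Lemma bv_entry (k : nat) (l : 'I_s) : bv K s k l 0 != 0 -> l = k :> nat.
Proof. by rewrite mxE; case: (_ =P k) => // _; rewrite eqxx. Qed.

Lemma col_bvE (x : 'cV[K]_s) : x = \sum_(k < s) x k 0 *: bv K s k.
Proof.
apply/colP => l; rewrite summxE (bigD1 l) //= big1 => [|k kl].
  by rewrite addr0 !mxE eqxx mulr1.
by rewrite !mxE (inj_eq val_inj) eq_sym (negPf kl) mulr0.
Qed.

Lemma Tmap_entry (j : 'Z_m) p a q (l k : 'I_s) :
  Tmap r t eps j p a q l k != 0 ->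
  (q = k + p %[mod s])%N /\ (l = k + a %[mod s])%N.
Proof.
rewrite mxE mulf_eq0 negb_or => /andP[].
move=> /mulmx_neq0[p' /beta_shifts-> /bv_entry->].
move=> /mulmx_neq0[a' /Trep_shifts-> /bv_entry->].
by rewrite ![(_ + k)%N]addnC.
Qed.

(* The tensor factor e_(q+1) of V only occurs in the image of one basis vector
   beta^k v_i. *)
Lemma Tmap_mul_neq0 (j : 'Z_m) p a q (y : 'cV[K]_s) :
  Tmap r t eps j p a q *m y != 0 ->
  exists k : 'I_s, [/\ y k 0 != 0, (q = k + p %[mod s])%N &
    exists c, Tmap r t eps j p a q *m y = c *: bv K s ((k + a) %% s)].
Proof.
set M := Tmap _ _ _ _ _ _ _ => /matrix0Pn[l [j0]]; rewrite (ord1 j0).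
move=> /mulmx_neq0[k Mlk yk]; exists k.
have [qk lk] := Tmap_entry Mlk; split=> //.
exists ((M *m y) l 0); apply/colP => l'; rewrite [RHS]mxE [bv _ _ _ _ _]mxE.
have [ll' | nll'] := eqVneq l' l.
  by rewrite ll' -lk modn_small // eqxx mulr1.
have -> : (l' : nat) == ((k + a) %% s)%N = false.
  apply: contraNF nll' => /eqP e; apply/eqP/val_inj.
  by rewrite /= e -lk modn_small.
rewrite mulr0; apply/eqP; apply: contraNT nll' => /mulmx_neq0[k' Ml'k' _].
have [qk' lk'] := Tmap_entry Ml'k'.
apply/eqP/val_inj; rewrite /= -(modn_small (ltn_ord l')) -(modn_small (ltn_ord l)).
rewrite lk' lk -[LHS]modnDml -[RHS]modnDml.
(* The letter [q] fixes [k] modulo [s], so only one row of the image can be nonzero. *)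
suff -> : k' = k %[mod s] by [].
by apply/eqP; rewrite -(eqn_modDr p) -qk' qk.
Qed.

End Monomial.

(** * Lifting paths of $Q_G$ by following weights *)

Section Lifting.

Variables (K : fieldType) (m r s t : nat) (eps : nat -> K).
Variables (D : {set 'Z_m}) (eta : 'Z_m -> K).
Hypotheses (s_prime : prime s) (rs1 : (r%:R : 'Z_m) ^+ s = 1).
Hypothesis D_repr : orbit_representatives r s D.
Hypothesis eps_neq0 : eps m != 0.

Local Notation ract := (Defs.ract r).
Local Notation Fix := (Fix m r).
Local Notation QA := (QA m r s).
Local Notation QG := (QG r s D).

(* All of T_i has weight [i] when [i] is fixed, so [y] is then unconstrained. *)
Definition has_weight (i : 'Z_m) (y : 'cV[K]_s) (w : 'Z_m) : Prop :=
  if i \in Fix then w = i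
  else exists k c, y = c *: bv K s k /\ w = ract k i.

Lemma has_weight_ract i y w :
  has_weight i y w -> exists k, w = ract k i.
Proof.
rewrite /has_weight; case: ifP => _ => [-> | [k [c [_ ->]]]]; last by exists k.
by exists 0%N; rewrite /Defs.ract mul1r.
Qed.

Lemma Zs_nat_eq k l : (k = l %[mod s])%N -> k%:R = l%:R :> 'Z_s.
Proof.
move=> kl; have s1 := prime_gt1 s_prime.
by rewrite -[LHS]Zp_nat_mod // kl Zp_nat_mod.
Qed.

(** One step of the lift: the only index $k$ compatible with [q] satisfies $w=r^ki$, so the arrow
    $x_q$ leaving [w] lies over [a], and the image again has a weight. *)
Lemma arrow_lift (a : arr QG) (q : 'I_s) y w :
    is_arrow a -> has_weight (src a).1 y w ->
    arrow_mx t eps eta a q *m y != 0 ->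
  Psi_arr a = Phi_arr D ((w, q, w - r%:R ^+ q) : arr QA) /\
  has_weight (tgt a).1 (arrow_mx t eps eta a q *m y) (w - r%:R ^+ q).
Proof.
have s_gt0 := prime_gt0 s_prime.
case: a => [[[i li] [p b]] [j lj]]; rewrite /is_arrow /= /vertexG /=.
case/and3P=> /andP[iD _] /andP[jD /eqP ljF] acond wt nz.
(* The projection [Tproj] occurs only when [j] is fixed, where [has_weight] ignores the vector;
   dropping it keeps the image nonzero. *)
have {}nz : Tmap r t eps j p b q *m y != 0 /\
  (j \notin Fix -> arrow_mx t eps eta (((i, li), (p, b), (j, lj)) : arr QG) q =
                   Tmap r t eps j p b q).
  move: nz ljF; rewrite /arrow_mx /=; case: lj => [l|] //=.
  move=> + <-; split=> //; apply: contraNneq nz.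
  by rewrite -mulmxA => ->; rewrite mulmx0.
case: nz => /(Tmap_mul_neq0 s_gt0 eps_neq0)[k [yk qk [c yE]]] aE.
have qE : (q : nat)%:R = p + (k : nat)%:R :> 'Z_s.
  by rewrite (Zs_nat_eq qk) natrD natr_Zp addrC.
have rq : r%:R ^+ q = r%:R ^+ k * r%:R ^+ p :> 'Z_m.
  by rewrite -exprD -(expr_mod _ rs1) qk expr_mod.
have [k0 wE] := has_weight_ract wt.
have repw : rep r s D w = i by rewrite wE rep_ract.
(* For fixed [i] every [k] serves; otherwise [y] is a multiple of one basis vector, whose index must
   be [k]. *)
have wk : w = ract k i.
  move: wt; rewrite /has_weight; case: ifP => [iF ->|_ [k1 [c1 [y1 ->]]]].
    by rewrite ract_fixed.
  by move: yk; rewrite y1 mxE mulf_eq0 negb_or => /andP[_ /bv_entry ->].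
have w'E : w - r%:R ^+ q = ract k (i - r%:R ^+ p).
  by rewrite wk rq /Defs.ract mulrBr.
move: acond; rewrite /arrow_cond /=.
case iF: (i \in Fix); case jF: (j \in Fix) => //.
(* Fixed source, free target: here [kappa] of the target weight is $k$, and $q-k=p$. *)
- case/andP=> /eqP b0 /eqP jE.
  have w'j : w - r%:R ^+ q = ract k j by rewrite w'E jE.
  split.
    rewrite /Psi_arr /Phi_arr /src /lab /tgt /= repw iF w'j.
    by rewrite rep_ract // kappa_ract ?jF // qE addrK b0.
  rewrite /has_weight jF aE ?jF // yE w'j.
  by exists (k : nat), c; rewrite b0 addn0 modn_small //.
(* Free source, fixed target: now $k$ is [kappa] of the source weight. *)
- case/andP=> /eqP b0 /eqP jE.
  have w'j : w - r%:R ^+ q = j by rewrite w'E -jE ract_fixed.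
  split; last by rewrite /has_weight jF.
  rewrite /Psi_arr /Phi_arr /src /lab /tgt /= repw iF w'j.
  have -> : rep r s D j = j.
    by have := rep_ract s_prime rs1 D_repr 0 jD; rewrite {1}/Defs.ract mul1r.
  by rewrite jF wk kappa_ract ?iF // qE addrK b0.
(* Both ends free: the values of [kappa] are $k$ and $k+b$, with difference $b$. *)
move/eqP=> jE.
have w'j : w - r%:R ^+ q = ract (k + b) j by rewrite w'E -jE -ractD.
split.
  rewrite /Psi_arr /Phi_arr /src /lab /tgt /= repw iF w'j.
  rewrite rep_ract // jF wk !kappa_ract ?iF ?jF // qE addrK.
  by rewrite natrD natr_Zp addrC addKr.
rewrite /has_weight jF aE ?jF // yE w'j.
by exists ((k + b) %% s)%N, c; rewrite ract_mod.
Qed.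

Lemma path_comp0 (p : seq (arr QG)) u : path_comp t eps eta p u 0 = 0.
Proof.
by elim: p u => [|a p IHp] [|q u] //; rewrite /path_comp /= mulmx0; apply: IHp.
Qed.

Lemma path_comp_mulmx (p : seq (arr QG)) u :
  exists M, forall x, path_comp t eps eta p u x = M *m x.
Proof.
elim: p u => [|a p IHp] [|q u];
  try by exists 1%:M => x; rewrite mul1mx.
have [M ME] := IHp u; exists (M *m arrow_mx t eps eta a q) => x.
by rewrite -mulmxA -ME.
Qed.

Lemma path_lift (p : seq (arr QG)) (u : seq 'I_s) x y w :
    size p = size u -> all (@is_arrow QG) p ->
    map (@src QG) p == belast x (map (@tgt QG) p) ->
    has_weight x.1 y w -> path_comp t eps eta p u y != 0 ->
  map (@Psi_arr _ _ _ _) p = map (@Phi_arr _ _ _ D) (stepsA r w u).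
Proof.
elim: p u x y w => [|a p IHp] [|q u] //= x y w [szE] /andP[a_arr p_arr].
move=> /eqP[/= srcE chain] wt nz; rewrite -srcE in wt.
(* A vector killed by the first arrow would stay zero to the end. *)
have nz1 : arrow_mx t eps eta a q *m y != 0.
  by apply: contraNneq nz; rewrite /path_comp /= => ->; apply/eqP/path_comp0.
have [-> wt1] := arrow_lift a_arr wt nz1; congr cons.
by apply: IHp wt1 nz => //; apply/eqP.
Qed.

Lemma wedge_comp_lift (p : seq (arr QG)) v x :
    vertexG r D v -> size p = s -> all (@is_arrow QG) p ->
    map (@src QG) p == belast v (map (@tgt QG) p) ->
    wedge_comp t eps eta p x != 0 ->
  exists w (sg : 'S_s),
    rep r s D w = v.1 /\
    map (@Psi_arr _ _ _ _) p = map (@Phi_arr _ _ _ D) (pathA r w sg).2.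
Proof.
move=> /andP[vD _] szp p_arr chain /sumr_neq0[sg].
rewrite scaler_eq0 negb_or => /andP[_].
set u := [seq sg k | k <- _] => nz.
have szu : size p = size u by rewrite size_map size_enum_ord.
(* The lift needs a starting vector with a weight: [x] itself at a fixed vertex, otherwise, by
   linearity, some basis vector not killed by the component. *)
suff [w [k [y [wE wt nz']]]] : exists w k y, [/\ w = ract k v.1,
    has_weight v.1 y w & path_comp t eps eta p u y != 0].
  exists w, sg; split; first by rewrite wE rep_ract.
  exact: path_lift szu p_arr chain wt nz'.
case vF: (v.1 \in Fix).
  by exists v.1, 0%N, x; split; rewrite ?ract_fixed // /has_weight vF.
have [M ME] := path_comp_mulmx p u; move: nz.
rewrite ME [x]col_bvE mulmx_sumr => /sumr_neq0[k].
rewrite -scalemxAr scaler_eq0 negb_or => /andP[_ nz].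
exists (ract k v.1), k, (bv K s k); rewrite ME; split=> //.
by rewrite /has_weight vF; exists k, 1; rewrite scale1r.
Qed.

Lemma last_vertexG (p : qpath QG) : is_qpath p -> vertexG r D (qend p).
Proof.
case: p => v p /and3P[/= vP + _]; rewrite /qend /=.
elim: p v vP => [|a p IHp] v vP //= /andP[/and3P[_ aP _]].
exact: IHp.
Qed.

(** A nonzero coefficient is a true Schur scalar; evaluating at a vector where [theta] does not
    vanish shows that the wedge composition is nonzero. *)
Lemma supp_omegaG_wedge (I : det_ident K r s D) (p : qpath QG) :
    is_det_ident t eps eta I -> p \in supp (omegaG t eps eta I) ->
  size p.2 = s /\ exists x, wedge_comp t eps eta p.2 x != 0.
Proof.
move=> hI; rewrite unfold_in /supp /omegaG; case: ifP; last by rewrite eqxx.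
case/andP=> p_path /eqP szp; rewrite mulf_eq0 negb_or => /andP[nz dim_nz].
split=> //; have [_ thE _ _] := hI _ (last_vertexG p_path).
(* The dimension factor makes the end space nonzero, and [theta] maps onto it. *)
have [x xV thx] : exists2 x, x \in Vsp eps eta (tau I (qend p)) &
    theta I (qend p) x != 0.
  have /negP/negP: Vsp eps eta (qend p) != 0%VS.
    by apply: contraNneq dim_nz => ->; rewrite dimv0.
  rewrite -vpick0 => nzv.
  have: vpick (Vsp eps eta (qend p)) \in Vsp eps eta (qend p) by apply: memv_pick.
  by rewrite -{2}thE => /memv_imgP[x xV e]; exists x; rewrite -?e.
exists x; move: nz; rewrite /coefG; case: (p.1 =P _) => [-> |]; last by rewrite eqxx.
(* The default of [xget] is 0, so a nonzero value has the defining property. *)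
case: xgetP => [c _ cP c0 | _]; last by rewrite eqxx.
by rewrite cP // scaler_eq0 negb_or c0.
Qed.

End Lifting.

(** * The support of $\omega_A$ *)

Section Support.

Variables (K : fieldType) (m r s : nat).

Lemma stepsA_labels (i : 'Z_m) (u : seq 'I_s) :
  map (@lab (QA m r s)) (stepsA r i u) = u.
Proof. by elim: u i => //= q u IHu i; rewrite IHu. Qed.

Lemma pathA_inj (i i' : 'Z_m) (sg sg' : 'S_s) :
  pathA r i sg = pathA r i' sg' -> i = i' /\ sg = sg'.
Proof.
case=> -> /(congr1 (map (@lab (QA m r s)))); rewrite !stepsA_labels.
by move/eq_in_map=> e; split=> //; apply/permP => k; apply: e; rewrite mem_enum.
Qed.

Lemma pathA_is_qpath (i : 'Z_m) (sg : 'S_s) : is_qpath (pathA r i sg).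
Proof.
rewrite /is_qpath /=; elim: [seq _ | k <- _] i => //= q u IHu i.
have /andP[-> /eqP ->] := IHu (i - r%:R ^+ q).
by rewrite !eqxx.
Qed.

(** Start and labels determine the path, so no terms cancel and the coefficient is a single sign. *)
Lemma pathA_supp (i : 'Z_m) (sg : 'S_s) : pathA r i sg \in supp (@omegaA K m r s).
Proof.
rewrite unfold_in /supp /omegaA (bigD1 i) //= (bigD1 sg) //= eqxx mulr1.
rewrite [X in _ + X + _]big1 => [|sg' sg'N]; last first.
  case: eqP => [/pathA_inj[_ e]|]; last by rewrite mulr0.
  by rewrite e eqxx in sg'N.
rewrite big1 => [|i' i'N]; last first.
  rewrite big1 // => sg' _; case: eqP => [/pathA_inj[e _]|]; last by rewrite mulr0.
  by rewrite e eqxx in i'N.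
by rewrite !addr0 signr_eq0.
Qed.

End Support.

Theorem theorem6p19 (R : realType) (m r s t : nat) (eps : nat -> R[i])
  (D : {set 'Z_m}) (eta : 'Z_m -> R[i]) (I : det_ident R[i] r s D)
  (hm : (0 < m)%N) (hr : (0 < r)%N) (ht : (0 < t)%N) (hs : prime s)
  (hmr : gcdn m r = 1%N)
  (hrs : (r ^ s = 1 %[mod m])%N)
  (hrt : ((r - 1) * t = 0 %[mod m])%N)
  (hr1 : (r <> 1 %[mod m])%N)
  (heps : forall k : nat, (0 < k)%N -> k.-primitive_root (eps k))
  (hFD : Fix m r \subset D)
  (hD : orbit_representatives r s D)
  (hDc : forall i : 'Z_m, i \in D -> i + (csum r s)%:R \in D)
  (heta : forall i : 'Z_m, i \in Fix m r -> eta i ^+ s = eps m ^+ (t * i))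
  (hI : is_det_ident t eps eta I)
  (p : qpath (QG r s D)) (hp : is_qpath p)
  (hsupp : p \in supp (omegaG t eps eta I)) :
  exists q : qpath (QA m r s),
    [/\ is_qpath q, q \in supp (@omegaA R[i] m r s) & Psi p = Phi D q].
Proof.
(* Needed for ['Z_m] to be the integers modulo [m]; for $m=1$ all residues agree, against [hr1]. *)
have m_gt1 : (1 < m)%N.
  rewrite ltn_neqAle hm andbT; apply/eqP => m1.
  by apply: hr1; rewrite -m1 !modn1.
have rs1 : (r%:R : 'Z_m) ^+ s = 1.
  by rewrite -natrX -Zp_nat_mod // hrs Zp_nat_mod.
have eps_neq0 : eps m != 0.
  apply/eqP => e0; have /eqP := prim_expr_order (heps m hm).
  by rewrite e0 expr0n eqn0Ngt hm eq_sym oner_eq0.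
have [szp [x nz]] := supp_omegaG_wedge hI hsupp.
case: p hp szp nz {hsupp} => v p /= /and3P[vP p_arr chain] szp nz.
have [w [sg [repw pE]]] :=
  wedge_comp_lift hs rs1 hD eps_neq0 vP szp p_arr chain nz.
exists (pathA r w sg); split; [exact: pathA_is_qpath | exact: pathA_supp |].
by rewrite /Psi /Phi /map_qpath /= repw pE.
Qed.
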